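(* Let $n\ge1$, let $H(p)=\frac{\langle Ap,p\rangle}{2}$ for a symmetric positive definite $n\times n$ matrix $A$, and let $T>0$. Let $u_T\in\mathrm{Lip}(\mathbb{R}^n)$ be such that $I_T(u_T):=\{u_0\in \mathrm{Lip}(\mathbb{R}^n) : S_T^+u_0=u_T\}$ is nonempty, and take any $u_0\in I_T(u_T)$. Let $$X_T(u_T):=\{z-T\,H_p(\nabla u_T(z)) : z\in\mathbb{R}^n\text{ such that }u_T\text{ is differentiable at }z\}.$$ Then for any $x_0\in\mathbb{R}^n$ the following two statements are equivalent: (i) $x_0\in X_T(u_T)$; (ii) there exist $b\in\mathbb{R}^n$ and $c\in\mathbb{R}$ such that $$u_0(x_0)=-\frac{\langle A^{-1}x_0,x_0\rangle}{2T}+b\cdot x_0+c$$ and $$u_0(x)>-\frac{\langle A^{-1}x,x\rangle}{2T}+b\cdot x+c\qquad\text{for all }x\in\mathbb{R}^n\setminus\{x_0\}.$$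
   Context: $\mathrm{Lip}(\mathbb{R}^n)$ is the set of (globally) Lipschitz continuous functions $\mathbb{R}^n\to\mathbb{R}$; $H_p$ is the gradient of $H$ (here $H_p(p)=Ap$). Viscosity solution: a uniformly continuous $u:[0,T]\times\mathbb{R}^n\to\mathbb{R}$ is a viscosity solution of $\partial_t u+H(D_xu)=0$ if for every $\varphi\in C^\infty([0,T]\times\mathbb{R}^n)$ and $(t_0,x_0)\in(0,T)\times\mathbb{R}^n$: $\partial_t\varphi(t_0,x_0)+H(\nabla_x\varphi(t_0,x_0))\le 0$ whenever $(t_0,x_0)$ is a local maximum of $u-\varphi$, and $\ge 0$ whenever it is a local minimum of $u-\varphi$. For $u_0\in\mathrm{Lip}(\mathbb{R}^n)$, $S_T^+u_0:=u(T,\cdot)\in\mathrm{Lip}(\mathbb{R}^n)$, where $u$ is the unique viscosity solution with $u(0,\cdot)=u_0$. It is given by the well-known Hopf–Lax formula $S_T^+u_0(x)=\min_{y\in\mathbb{R}^n}\big[u_0(y)+T\,L\big(\frac{x-y}{T}\big)\big]$ with $L(q)=\max_{p}[q\cdot p-H(p)]=\frac{\langle A^{-1}q,q\rangle}{2}$. *)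

(* Defs.v *)
From HB Require Import structures.
From mathcomp Require Import all_boot all_order all_algebra.
From mathcomp Require Import all_classical all_reals all_analysis.
Set Implicit Arguments.
Unset Strict Implicit.
Unset Printing Implicit Defensive.
Import Order.TTheory GRing.Theory Num.Theory.
Import numFieldNormedType.Exports.

Local Open Scope classical_set_scope.
Local Open Scope ring_scope.

(* R^n is 'cV[R]_n; its library norm is the sup norm, which is equivalent to the
   Euclidean one, so that "Lipschitz", "uniformly continuous", "differentiable"
   and "local extremum" have their usual meaning. *)

Definition dot (R : realType) (n : nat) (p q : 'cV[R]_n) : R :=
  \sum_(i < n) p i 0 * q i 0.

(* The vector of partial derivatives. *)
Definition grad (R : realType) (n : nat) (f : 'cV[R]_n -> R) (x : 'cV[R]_n)
  : 'cV[R]_n := \col_(i < n) 'D_(delta_mx i 0) f x.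

Definition posdefmx (R : realType) (n : nat) (A : 'M[R]_n) : Prop :=
  A^T = A /\ forall p : 'cV[R]_n, p != 0 -> 0 < dot (A *m p) p.

Definition quadH (R : realType) (n : nat) (A : 'M[R]_n) (p : 'cV[R]_n) : R :=
  dot (A *m p) p / 2.

Definition Lip (R : realType) (n : nat) : set ('cV[R]_n -> R) :=
  [set f | [lipschitz f x | x in [set: 'cV[R]_n]]].

(* f is of class C^k: on a finite-dimensional space, differentiability together
   with all directional derivatives being C^(k-1) is the usual notion. *)
Fixpoint Ck (R : realType) (V : normedModType R) (k : nat) (f : V -> R) : Prop :=
  match k with
  | 0%N => continuous f
  | k'.+1 => (forall x : V, differentiable f x) /\
             (forall v : V, Ck k' (fun x => 'D_v f x))
  end.

Definition Cinfty (R : realType) (V : normedModType R) (f : V -> R) : Prop :=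
  forall k : nat, Ck k f.

Definition local_max (R : realType) (X : topologicalType) (f : X -> R) (x : X)
  : Prop := \forall y \near x, f y <= f x.

Definition local_min (R : realType) (X : topologicalType) (f : X -> R) (x : X)
  : Prop := \forall y \near x, f x <= f y.

(* Viscosity solution of d_t u + H(D_x u) = 0 on [0, T] x R^n.
   Functions on [0, T] x R^n are represented by functions on R x R^n; the values
   of u outside [0, T] x R^n are irrelevant, since (0, T) x R^n is open.
   C^oo([0, T] x R^n) is the set of restrictions of smooth functions on R x R^n. *)
Record viscosity_solution (R : realType) (n : nat) (H : 'cV[R]_n -> R) (T : R)
    (u : R * 'cV[R]_n -> R) : Prop := {
  viscosity_uc :
    unif_continuous (u : subspace (`[0, T] `*` [set: 'cV[R]_n]) -> R) ;
  viscosity_sub : forall phi : R * 'cV[R]_n -> R, Cinfty phi ->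
    forall (t0 : R) (x0 : 'cV[R]_n), 0 < t0 < T ->
    local_max (fun z => u z - phi z) (t0, x0) ->
    derive1 (fun t => phi (t, x0)) t0 + H (grad (fun x => phi (t0, x)) x0) <= 0 ;
  viscosity_super : forall phi : R * 'cV[R]_n -> R, Cinfty phi ->
    forall (t0 : R) (x0 : 'cV[R]_n), 0 < t0 < T ->
    local_min (fun z => u z - phi z) (t0, x0) ->
    0 <= derive1 (fun t => phi (t, x0)) t0 + H (grad (fun x => phi (t0, x)) x0)
}.

(* S_T^+ u0 = v, as the graph of S_T^+: the solution with initial datum u0
   (unique on [0, T] x R^n) is equal to v at time T. *)
Definition ST_plus (R : realType) (n : nat) (H : 'cV[R]_n -> R) (T : R)
    (u0 v : 'cV[R]_n -> R) : Prop :=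
  exists u : R * 'cV[R]_n -> R,
    [/\ viscosity_solution H T u, forall x, u (0, x) = u0 x
      & forall x, u (T, x) = v x].

Definition I_T (R : realType) (n : nat) (H : 'cV[R]_n -> R) (T : R)
    (uT : 'cV[R]_n -> R) : set ('cV[R]_n -> R) :=
  [set u0 | Lip u0 /\ ST_plus H T u0 uT].

Definition X_T (R : realType) (n : nat) (H : 'cV[R]_n -> R) (T : R)
    (uT : 'cV[R]_n -> R) : set 'cV[R]_n :=
  [set z - T *: grad H (grad uT z) | z in [set z | differentiable uT z]].

(* Main.v *)
(* Write Q x = <A^-1 x, x>.  The Hopf-Lax formula is obtained directly from the
   definition of viscosity solutions, without a comparison principle, because
   both kernels Q (x - y) / (2 (tau + t)) and - Q (x - y) / (2 (T - t)) solve the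
   equation classically: the first one, used as a test function touching u from
   above, gives u (T, x) <= u0 y + Q (x - y) / (2 T) as tau -> 0; the second one,
   touching u from below, shows that min_y (u (t, y) + Q (x - y) / (2 (T - t)))
   does not decrease in t, hence u (T, x) >= min_y (u0 y + Q (x - y) / (2 T)).

   Expanding Q (z - x), condition (ii) says exactly that x0 is the unique
   minimizer of y |-> u0 y + Q (z - y) / (2 T) for z = T A b.  If uT is
   differentiable at z, every minimizer y satisfies grad uT z = A^-1 (z - y) / T,
   i.e. y = z - T A grad uT z, hence is unique.  Conversely, if the minimizer at z
   is unique then the minimizers at z + h converge to it as h -> 0, which makes uT
   differentiable at z. *)
Require Import Defs.
From HB Require Import structures.
From mathcomp Require Import all_boot all_order all_algebra.
From mathcomp Require Import all_classical all_reals all_analysis.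
From mathcomp Require Import ring lra.
Import Order.TTheory GRing.Theory Num.Theory.
Import numFieldNormedType.Exports.
Local Open Scope classical_set_scope.
Local Open Scope ring_scope.

(** * Quadratic forms *)

Section Dot.
Context {R : realType} {n : nat}.
Implicit Types (p q x y : 'cV[R]_n) (M : 'M[R]_n).

Lemma dotE p q : dot p q = (p^T *m q) 0 0.
Proof. by rewrite mxE; apply: eq_bigr => i _; rewrite mxE. Qed.

Lemma dotC p q : dot p q = dot q p.
Proof. by apply: eq_bigr => i _; rewrite mulrC. Qed.

Lemma dotDl p q x : dot (p + q) x = dot p x + dot q x.
Proof. by rewrite !dotE linearD mulmxDl mxE. Qed.

Lemma dotZl a p x : dot (a *: p) x = a * dot p x.
Proof. by rewrite !dotE linearZ -scalemxAl mxE. Qed.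

Lemma dotDr p q x : dot x (p + q) = dot x p + dot x q.
Proof. by rewrite !(dotC x) dotDl. Qed.

Lemma dotZr a p x : dot x (a *: p) = a * dot x p.
Proof. by rewrite !(dotC x) dotZl. Qed.

Lemma dotNl p x : dot (- p) x = - dot p x.
Proof. by rewrite -scaleN1r dotZl mulN1r. Qed.

Lemma dotNr p x : dot x (- p) = - dot x p.
Proof. by rewrite !(dotC x) dotNl. Qed.

Lemma dot0l x : dot 0 x = 0.
Proof. by rewrite -(scale0r x) dotZl mul0r. Qed.

Lemma dot0r x : dot x 0 = 0.
Proof. by rewrite dotC dot0l. Qed.

Lemma dot_delta p i : dot p (delta_mx i 0) = p i 0.
Proof.
rewrite /dot (bigD1 i)//= big1 ?addr0 => [|j ji]; first by rewrite mxE !eqxx mulr1.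
by rewrite mxE (negPf ji) mulr0.
Qed.

Lemma dot_mulmx M x y : dot (M *m x) y = dot x (M^T *m y).
Proof. by rewrite !dotE trmx_mul mulmxA. Qed.

Lemma dot_symC {M} x y : M^T = M -> dot (M *m x) y = dot (M *m y) x.
Proof. by move=> sM; rewrite dot_mulmx sM dotC. Qed.

Lemma dot_symD {M} x y : M^T = M ->
  dot (M *m (x + y)) (x + y) =
  dot (M *m x) x + 2 * dot (M *m x) y + dot (M *m y) y.
Proof.
move=> sM; rewrite mulmxDr dotDl !dotDr (dot_symC y x sM).
by ring.
Qed.

Lemma dot_mulmxZ M a x : dot (M *m (a *: x)) (a *: x) = a ^+ 2 * dot (M *m x) x.
Proof. by rewrite -scalemxAr dotZl dotZr; ring. Qed.

Lemma dot_mulmxN M x : dot (M *m (- x)) (- x) = dot (M *m x) x.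
Proof. by rewrite mulmxN dotNl dotNr opprK. Qed.

Lemma ler_coord_norm x i : `|x i 0| <= `|x|.
Proof.
rewrite [leRHS]/Num.norm /= mx_normrE.
by apply/bigmax_geP; right; exists (i, 0).
Qed.

Lemma cV_norm_le x b : 0 <= b -> (forall i, `|x i 0| <= b) -> `|x| <= b.
Proof.
move=> b0 h; rewrite [leLHS]/Num.norm /= mx_normrE.
by apply/bigmax_leP; split => // -[i j] _ /=; rewrite ord1.
Qed.

Lemma dot_mulmx_bound M :
  exists2 C, 0 < C & forall x y, `|dot (M *m x) y| <= C * `|x| * `|y|.
Proof.
exists (1 + \sum_(i < n) \sum_(j < n) `|M i j|).
  by rewrite ltr_pwDl// sumr_ge0// => i _; rewrite sumr_ge0.
move=> x y; apply: (@le_trans _ _ (\sum_(i < n) \sum_(j < n) `|M i j| * `|x| * `|y|)).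
  apply: le_trans (ler_norm_sum _ _ _) _; apply: ler_sum => i _.
  rewrite mxE normrM -!mulr_suml; apply: ler_pM => //; last exact: ler_coord_norm.
  apply: le_trans (ler_norm_sum _ _ _) _; rewrite mulr_suml.
  by apply: ler_sum => j _; rewrite normrM ler_wpM2l// ler_coord_norm.
under eq_bigr do rewrite -!mulr_suml; rewrite -!mulr_suml.
by rewrite !ler_wpM2r// lerDr.
Qed.

End Dot.

(** * Positive definite matrices: Cauchy-Schwarz and coercivity of the inverse *)

Section PosDef.
Context {R : realType} {n : nat} {A : 'M[R]_n}.
Hypothesis hA : posdefmx A.

Lemma posdef_unitmx : A \in unitmx.
Proof.
rewrite -unitmx_tr -row_free_unit; apply/row_freeP.
apply: contrapT => hn.
have /eqP : kermx A^T != 0.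
  rewrite kermx_eq0; apply/negP => /row_freeP h; exact: hn.
rewrite -/(_ <> _) => /eqP /rowV0Pn [v vk v0].
move/sub_kermxP: vk => vA.
have := hA.2 v^T; rewrite trmx_eq0 => /(_ v0).
rewrite -[A]trmxK -trmx_mul vA trmx0.
by rewrite dot0l ltxx.
Qed.

Lemma posdef_invmx_sym : (invmx A)^T = invmx A.
Proof. by rewrite trmx_inv hA.1. Qed.

Lemma posdef_ge0 x : 0 <= dot (A *m x) x.
Proof.
have [->|x0] := eqVneq x 0; last exact: ltW (hA.2 _ x0).
by rewrite mulmx0 dot0l.
Qed.

(** Non-negativity of the form at [x] minus its [A]-orthogonal projection on [y], multiplied by
    [dot (A *m y) y]. *)
Lemma posdef_cauchy x y :
  dot (A *m x) y ^+ 2 <= dot (A *m x) x * dot (A *m y) y.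
Proof.
have [->|y0] := eqVneq y 0.
  by rewrite mulmx0 dot0l dot0r mulr0 expr0n.
have yy := hA.2 _ y0.
have := posdef_ge0 (x + - (dot (A *m x) y / dot (A *m y) y) *: y).
rewrite (dot_symD _ _ hA.1) dot_mulmxZ dotZr => h.
rewrite -subr_ge0; have := mulr_ge0 (ltW yy) h; congr (_ <= _).
by field; exact: lt0r_neq0.
Qed.

(** Writing [x = A *m xi], Cauchy-Schwarz against the [i]-th basis vector bounds [x i 0 ^+ 2] by
    [A i i * dot (invmx A *m x) x]. The trace plus 1 dominates every [A i i] and is positive. *)
Lemma posdef_invmx_coercive :
  exists2 C, 0 < C & forall x : 'cV[R]_n, `|x| ^+ 2 <= C * dot (invmx A *m x) x.
Proof.
have Au := posdef_unitmx.
have Aii i : 0 <= A i i.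
  by have := posdef_ge0 (delta_mx i 0); rewrite dot_delta -colE mxE.
pose C := 1 + \sum_i A i i.
have C0 : 0 < C by rewrite /C ltr_pwDl// sumr_ge0.
exists C => // x.
have [xi ->] : exists xi, x = A *m xi by exists (invmx A *m x); rewrite mulKVmx.
rewrite mulKmx// (dotC xi).
set q := dot _ _; have q0 : 0 <= q by exact: posdef_ge0.
suff : `|A *m xi| <= Num.sqrt (C * q).
  move=> h; rewrite -[leRHS]sqr_sqrtr ?mulr_ge0 ?(ltW C0)//.
  by rewrite lerXn2r ?nnegrE ?sqrtr_ge0.
apply: cV_norm_le => [|i]; first exact: sqrtr_ge0.
rewrite -sqrtr_sqr; apply: ler_wsqrtr.
have := posdef_cauchy xi (delta_mx i 0).
rewrite !dot_delta -colE [in X in _ <= X]mxE => /le_trans; apply.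
rewrite mulrC; apply: ler_wpM2r => //.
by rewrite /C (bigD1 i)//= addrCA lerDl addr_ge0// sumr_ge0.
Qed.

End PosDef.

(** * Derivatives along lines and smooth functions *)

Section Quadratic.
Context {R : realType} {V : normedModType R}.

Lemma cvg_affine (l c : R) : l + h * c @[h --> 0^'] --> l.
Proof.
have : l + h * c @[h --> 0^'] --> l + 0 * c.
  apply: cvgD; [exact: cvg_cst|apply: cvgMr_tmp; exact: nbhs_dnbhs].
by rewrite mul0r addr0.
Qed.

Lemma is_derive_quadratic {f : V -> R} {x v : V} l c :
  (forall s, f (s *: v + x) = f x + s * l + s ^+ 2 * c) -> is_derive x v f l.
Proof.
move=> h.
have cv : h^-1 *: ((f \o shift x) (h *: v) - f x) @[h --> 0^'] --> (l : R).
  apply: (@cvg_trans _ (l + h * c @[h --> 0^'])).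
    apply: near_eq_cvg; near=> s => /=.
    have s0 : s != 0 by near: s; exact: nbhs_dnbhs_neq.
    by rewrite h /GRing.scale /=; field.
  exact: cvg_affine.
apply: DeriveDef; first by apply/cvg_ex; exists l.
exact: cvg_lim.
Unshelve. all: by end_near. Qed.

Lemma derive_quadratic {f : V -> R} {x v : V} l c :
  (forall s, f (s *: v + x) = f x + s * l + s ^+ 2 * c) -> 'D_v f x = l.
Proof. by move=> /is_derive_quadratic[]. Qed.

(** A parabola lies above [f] on the line and meets it at [s = 0]: right difference quotients give
    ['D_v f x <= l], left ones the reverse. *)
Lemma derive_le_quadratic {f : V -> R} {x v : V} l c : derivable f x v ->
  (forall s, f (s *: v + x) <= f x + s * l + s ^+ 2 * c) -> 'D_v f x = l.
Proof.
move=> df h; set d := 'D_v f x.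
have cvf : h^-1 *: ((f \o shift x) (h *: v) - f x) @[h --> 0^'] --> (d : R).
  exact: df.
have cvq : h^-1 *: ((f \o shift x) (h *: v) - f x) - (l + h * c) @[h --> 0^']
    --> d - l.
  by apply: cvgB => //; exact: cvg_affine.
apply/eqP; rewrite -subr_eq0 eq_le; apply/andP; split.
- apply: (cvgr_to_le (cvg_dnbhs_at_right cvq)); near=> s.
  have s0 : 0 < s by [].
  rewrite subr_le0 ler_pdivrMl// lerBlDl /=.
  by apply: le_trans (h s) _; rewrite le_eqVlt; apply/orP; left; apply/eqP; ring.
- apply: (cvgr_to_ge (cvg_dnbhs_at_left cvq)); near=> s.
  have s0 : s < 0 by [].
  rewrite subr_ge0 ler_ndivlMl// lerBlDl /=.
  by apply: le_trans (h s) _; rewrite le_eqVlt; apply/orP; left; apply/eqP; ring.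
Unshelve. all: by end_near. Qed.

Lemma differentiable_approx {f : V -> R} {x : V} (L : {linear V -> R}) :
  continuous L ->
  (forall e, 0 < e -> \forall h \near (0 : V), `|f (x + h) - f x - L h| <= e * `|h|) ->
  differentiable f x.
Proof.
move=> cL hL.
have L_diff : f \o shift x = cst (f x) + L +o_ (0 : V) id.
  apply/eqaddoP => e /hL; apply: filterS => h hle.
  suff : `|f (h + x) - (f x + L h)| <= e * `|h| by [].
  by rewrite opprD addrA (addrC h).
by apply/diff_locallyP; rewrite (diff_unique cL L_diff).
Qed.

End Quadratic.

Section Smooth.
Context {R : realType} {V : normedModType R}.
Implicit Types f g : V -> R.

Lemma CkW k f : Ck k.+1 f -> Ck k f.
Proof.
elim: k f => [|k ih] f [df Df].
  by move=> x; exact: differentiable_continuous.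
by split=> // v; apply: ih; exact: Df.
Qed.

Lemma Ck_eq k f g : f =1 g -> Ck k f -> Ck k g.
Proof. by move=> /funext ->. Qed.

Lemma Ck_cst k (a : R) : Ck k (fun _ : V => a).
Proof.
elim: k a => [|k ih] a /=; first exact: cst_continuous.
split=> [x|v]; first exact: differentiable_cst.
by apply: Ck_eq (ih 0) => x; rewrite derive_cst.
Qed.

Lemma CkD k f g : Ck k f -> Ck k g -> Ck k (fun x => f x + g x).
Proof.
elim: k f g => [|k ih] f g.
  by move=> cf cg x; apply: cvgD; [exact: cf|exact: cg].
move=> [df Df] [dg Dg]; split=> [x|v]; first exact: differentiableD.
apply: Ck_eq (ih _ _ (Df v) (Dg v)) => x.
by rewrite deriveD//; exact: diff_derivable.
Qed.

Lemma CkM k f g : Ck k f -> Ck k g -> Ck k (fun x => f x * g x).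
Proof.
elim: k f g => [|k ih] f g.
  by move=> cf cg x; apply: cvgM; [exact: cf|exact: cg].
move=> Cf Cg; have [df Df] := Cf; have [dg Dg] := Cg.
split=> [x|v]; first exact: differentiableM.
apply: Ck_eq (CkD _ _ _ (ih _ _ (CkW _ _ Cf) (Dg v)) (ih _ _ (CkW _ _ Cg) (Df v))).
by move=> x; rewrite deriveM//; exact: diff_derivable.
Qed.

Lemma Ck_sum k m (f : 'I_m -> V -> R) : (forall i, Ck k (f i)) ->
  Ck k (fun x => \sum_(i < m) f i x).
Proof.
elim: m f => [|m ih] f hf.
  by apply: Ck_eq (Ck_cst k 0) => x; rewrite big_ord0.
apply: Ck_eq (CkD _ _ _ (ih (fun i => f (widen_ord (leqnSn m) i)) _) (hf ord_max)).
  by move=> x; rewrite big_ord_recr.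
by move=> i; exact: hf.
Qed.

(** The derivative in direction [v] is the constant [l v]. This covers the coordinates, from which
    all test functions are built by sums and products. *)
Lemma Ck_affine k f (l : V -> R) : (forall x, differentiable f x) ->
  (forall x v s, f (s *: v + x) = f x + s * l v) -> Ck k f.
Proof.
move=> df fE; case: k => [x|k]; first exact: differentiable_continuous.
split=> // v; apply: Ck_eq (Ck_cst k (l v)) => x.
by apply/esym/(derive_quadratic _ 0) => s; rewrite mulr0 addr0.
Qed.

Lemma CinftyN f : Cinfty f -> Cinfty (fun x => - f x).
Proof.
move=> Cf k; apply: Ck_eq (CkM _ _ _ (Ck_cst k (-1)) (Cf k)) => x.
by rewrite mulN1r.
Qed.

End Smooth.

(** * Polynomial test functions and gradients of quadratic forms *)

Section TestFunction.
Context {R : realType} {n : nat}.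
Implicit Types (M : 'M[R]_n) (x y p : 'cV[R]_n) (t a b : R).

Lemma Ck_time k : Ck k (fun z : R * 'cV[R]_n => z.1).
Proof.
apply: (Ck_affine k _ (fun v : R * 'cV[R]_n => v.1)) => [z|z v s].
  by apply: linear_differentiable => ?; exact: cvg_fst.
by rewrite /= addrC.
Qed.

Lemma Ck_coord k i : Ck k (fun z : R * 'cV[R]_n => z.2 i 0).
Proof.
apply: (Ck_affine k _ (fun v : R * 'cV[R]_n => v.2 i 0)) => [z|z v s].
  apply: (@differentiable_comp _ _ _ _ snd (fun x : 'cV[R]_n => x i 0)).
    by apply: linear_differentiable => ?; exact: cvg_snd.
  exact: differentiable_coord.
by rewrite /= !mxE addrC.
Qed.

Lemma Ck_quadratic_time k t a b c :
  Ck k (fun z : R * 'cV[R]_n => a + b * (z.1 - t) + c * (z.1 - t) ^+ 2).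
Proof.
have h : Ck k (fun z : R * 'cV[R]_n => z.1 - t).
  by apply: CkD; [exact: Ck_time|exact: Ck_cst].
apply: CkD; last by apply: CkM; [exact: Ck_cst|exact: CkM].
by apply: CkD; [exact: Ck_cst|apply: CkM => //; exact: Ck_cst].
Qed.

Lemma Ck_dot_mulmx k M y :
  Ck k (fun z : R * 'cV[R]_n => dot (M *m (z.2 - y)) (z.2 - y)).
Proof.
have h i : Ck k (fun z : R * 'cV[R]_n => (z.2 - y) i 0).
  apply: (Ck_eq _ (fun z : R * 'cV[R]_n => z.2 i 0 + (- y i 0))).
    by move=> z; rewrite !mxE.
  by apply: CkD; [exact: Ck_coord|exact: Ck_cst].
apply: Ck_sum => i; apply: CkM => //.
apply: (Ck_eq _ (fun z : R * 'cV[R]_n => \sum_(j < n) M i j * (z.2 - y) j 0)).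
  by move=> z; rewrite mxE.
by apply: Ck_sum => j; apply: CkM => //; exact: Ck_cst.
Qed.

Lemma continuous_dot_mulmx M y :
  continuous (fun z : R * 'cV[R]_n => dot (M *m (z.2 - y)) (z.2 - y)).
Proof. exact: (Ck_dot_mulmx 0). Qed.

Lemma grad_dot_mulmx M y a b x : M^T = M ->
  grad (fun x => dot (M *m (x - y)) (x - y) * a + b) x =
  (2 * a) *: (M *m (x - y)).
Proof.
move=> sM; apply/colP => i; rewrite [LHS]mxE [RHS]mxE -(dot_delta (M *m _)).
apply: (derive_quadratic _ (dot (M *m delta_mx i 0) (delta_mx i 0) * a)) => s.
rewrite (_ : s *: delta_mx i 0 + x - y = x - y + s *: delta_mx i 0); last first.
  by rewrite -addrA addrC.
by rewrite (dot_symD _ _ sM) dot_mulmxZ dotZr; ring.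
Qed.

Lemma grad_quadH (A : 'M[R]_n) p : A^T = A -> grad (quadH A) p = A *m p.
Proof.
move=> sA.
have -> : quadH A = fun x => dot (A *m (x - 0)) (x - 0) * 2^-1 + 0.
  by apply/funext => x; rewrite subr0 addr0.
by rewrite grad_dot_mulmx// subr0 divff ?scale1r.
Qed.

End TestFunction.

(** * Compact balls and attained maxima *)

Section Compactness.
Context {R : realType} {n : nat}.

(** Carries the compactness of boxes of row vectors, [rV_compact], over to columns. *)
Lemma trmx_continuous : continuous (fun x : 'rV[R]_n => x^T).
Proof.
move=> x A /nbhs_ballP[e e0 hA]; apply/nbhs_ballP; exists e => //= z.
rewrite -ball_normE /= => xz; apply: hA; rewrite -ball_normE /=.
apply: le_lt_trans xz; apply: cV_norm_le => // i.
have := ler_coord_norm (x - z)^T i; rewrite !mxE => /le_trans; apply.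
rewrite -[in leRHS](trmxK (x - z)) [leLHS]/Num.norm [leRHS]/Num.norm /= !mx_normrE.
apply/bigmax_leP; split => [|[j l] _ /=]; first by apply/bigmax_geP; left.
by apply/bigmax_geP; right; exists (l, j) => //=; rewrite !mxE.
Qed.

Lemma compact_norm_le (r : R) : compact [set x : 'cV[R]_n | `|x| <= r].
Proof.
have [r0|r0] := ltP r 0.
  suff -> : [set x : 'cV[R]_n | `|x| <= r] = set0 by exact: compact0.
  by apply/seteqP; split => // x /= xr; have := le_lt_trans xr r0; rewrite normr_lt0.
have cK : compact [set x : 'rV[R]_n | forall i, `[- r, r]%classic (x ord0 i)].
  by apply: (@rV_compact _ _ (fun=> `[- r, r]%classic)) => _; exact: segment_compact.
have := continuous_compact (continuous_subspaceT trmx_continuous) cK.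
congr compact; apply/seteqP; split => [x [w /= h <-]|x /= h].
  apply: cV_norm_le => // i; rewrite mxE ler_norml.
  by have := h i; rewrite /= in_itv.
exists x^T; last by rewrite trmxK.
move=> i /=; rewrite mxE in_itv /= -ler_norml.
exact: le_trans (ler_coord_norm _ _) h.
Qed.

(** The maximum over the compact part [|z.2| <= r'] is global, since [r'] is large enough for that
    part to contain [p], whose value dominates everything farther out. With [S = 0] the lemma serves
    functions of space alone. *)
Lemma strip_max (S r : R) (f : R * 'cV[R]_n -> R) p :
  let strip := `[0, S]%classic `*` [set: 'cV[R]_n] in
  {within strip, continuous f} -> strip p ->
  (forall z, strip z -> r < `|z.2| -> f z <= f p) ->
  exists2 m, strip m & forall z, strip z -> f z <= f m.
Proof.
move=> strip cf pS far; pose r' := Num.max r `|p.2|.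
pose K := `[0, S]%classic `*` [set x : 'cV[R]_n | `|x| <= r'].
have KS : K `<=` strip by move=> z [].
have cK : compact K.
  by apply: compact_setX; [exact: segment_compact|exact: compact_norm_le].
have Kp : K p by split; [case: pS|rewrite /= /r' le_max lexx orbT].
have [|m mK mmax] := compact_EVT_max _ cK (continuous_subspaceW KS cf).
  by exists p.
exists m; first by apply: KS; exact: set_mem.
move=> z zS; have [zr|zr] := leP `|z.2| r'.
  by apply: mmax; rewrite inE; split => //; case: zS.
apply: le_trans (mmax p _); last exact/mem_set.
by apply: far => //; apply: le_lt_trans zr; rewrite /r' le_max lexx.
Qed.

End Compactness.

(** * The test-function argument *)

Section Kernel.
Context {R : realType} {n : nat} {A : 'M[R]_n}.
Hypothesis hA : posdefmx A.
Let M := invmx A.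
Let Q x := dot (M *m x) x.

(** The right side is a parabola tangent to the inverse at [s0]. It replaces the singular time
    factors of kernel and penalty by polynomials, so that the test function is smooth everywhere. *)
Lemma inv_le_quadratic (m s s0 : R) : 0 < m -> m <= s -> 0 < s0 ->
  s^-1 <= s0^-1 - (s - s0) / s0 ^+ 2 + (s - s0) ^+ 2 / (m * s0 ^+ 2).
Proof.
move=> m0 ms s00; have s_gt0 := lt_le_trans m0 ms.
rewrite -subr_ge0.
have -> : s0^-1 - (s - s0) / s0 ^+ 2 + (s - s0) ^+ 2 / (m * s0 ^+ 2) - s^-1
    = (s - s0) ^+ 2 / s0 ^+ 2 * (m^-1 - s^-1).
  by field; rewrite !gt_eqF.
by rewrite mulr_ge0 ?divr_ge0 ?sqr_ge0// subr_ge0 lef_pV2.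
Qed.

Lemma linear_le_quadratic (C K c : R) : 0 < c ->
  exists r, forall w, r < w -> C + K * w <= c * w ^+ 2.
Proof.
(* This threshold forces both [1 <= w] and [|C| + |K| <= c * w]. *)
move=> c0; exists (1 + (`|C| + `|K|) / c) => w.
rewrite -ltrBrDl ltr_pdivrMr// => h.
have w1 : 1 <= w.
  rewrite -subr_ge0 -(pmulr_lge0 _ c0); apply/ltW; apply: le_lt_trans h.
  by rewrite addr_ge0.
have C1 := ler_norm C; have K1 := ler_norm K; have C0 := normr_ge0 C.
have : `|C| + `|K| <= c * w by nra.
by nra.
Qed.

Lemma posdef_invmx_ge0 x : 0 <= Q x.
Proof.
have [C C0 h] := posdef_invmx_coercive hA.
by rewrite -(pmulr_rge0 _ C0); apply: le_trans (h x); rewrite exprn_ge0.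
Qed.

(** For [a = 1 / (2 * th)] the value is [Q (x - y) / (2 * th ^+ 2)], which multiplied by [e] cancels
    the time derivative of the kernel, as [th] has slope [e]. *)
Lemma grad_kernel a b y x :
  quadH A (grad (fun x => Q (x - y) * a + b) x) = 2 * a ^+ 2 * Q (x - y).
Proof.
rewrite grad_dot_mulmx ?posdef_invmx_sym// /quadH dot_mulmxZ.
rewrite mulKVmx ?posdef_unitmx// (dotC (x - y)) -/(Q _).
by field.
Qed.

(* With [e = 1] and [v = u] the kernel is the forward one; with [e = -1] and
   [v = - u] it is the backward one. *)
Variables (e th0 S : R) (v : R * 'cV[R]_n -> R) (y : 'cV[R]_n).
Let strip := `[0, S]%classic `*` [set: 'cV[R]_n].
Let th t := th0 + e * t.
Hypotheses (S_gt0 : 0 < S) (th0_gt0 : 0 < th 0) (thS_gt0 : 0 < th S).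
Hypothesis v_cont : {within strip, continuous v}.
Hypothesis v_growth :
  exists C K, forall z, strip z -> v z <= C + K * `|z.2|.
Hypothesis v_test : forall phi, Cinfty phi -> forall t0 x0, 0 < t0 < S ->
  local_max (fun z => v z - phi z) (t0, x0) ->
  derive1 (fun t => phi (t, x0)) t0
    + e * quadH A (grad (fun x => phi (t0, x)) x0) <= 0.

(** [th] is affine, so its minimum over [[0, S]] is at an endpoint, whatever the sign of [e]. *)
Let thm := Num.min (th 0) (th S).

Let thm_gt0 : 0 < thm.
Proof. by rewrite lt_min th0_gt0. Qed.

Let th_ge t : 0 <= t <= S -> thm <= th t.
Proof.
move=> /andP[t0 tS]; rewrite /thm ge_min /th mulr0 addr0.
have [e0|e0] := leP 0 e; first by rewrite lerDl mulr_ge0.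
by apply/orP; right; rewrite lerD2l ler_nM2l.
Qed.

(** On the strip [th] is bounded above, so the kernel grows quadratically in space, uniformly in
    time, and beats the linear growth of [v]; a non-negative [k] only helps. *)
Lemma kernel_penalized_max (k : R -> R) :
  {in `[0, S]%classic, continuous k} -> (forall t, 0 <= t <= S -> 0 <= k t) ->
  let f z := v z - Q (z.2 - y) / (2 * th z.1) - k z.1 in
  exists2 m, strip m & forall z, strip z -> f z <= f m.
Proof.
move=> ck k0 f.
have [C [K vCK]] := v_growth; have [D D0 QD] := posdef_invmx_coercive hA.
pose thM := th0 + `|e| * S.
have th_le t : 0 <= t <= S -> th t <= thM.
  move=> /andP[t0 tS]; rewrite lerD2l; apply: le_trans (ler_norm _) _.
  by rewrite normrM ler_wpM2l// ger0_norm.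
have thM0 : 0 < thM.
  by apply: lt_le_trans th0_gt0 (th_le _ _); rewrite lexx ltW.
pose c := (D * (2 * thM))^-1; have c0 : 0 < c by rewrite invr_gt0 !mulr_gt0.
have p0 : strip (0, y) by split => //=; rewrite in_itv /= lexx ltW.
have [r hr] := linear_le_quadratic (C + `|K| * `|y| - f (0, y)) `|K| c c0.
have stripE z : strip z -> 0 <= z.1 <= S by case=> /=; rewrite in_itv.
have [||m mS mm] := strip_max S (r + `|y|) f (0, y) _ p0; last by exists m.
  move=> z; apply: cvgB; [apply: cvgB|]; first exact: v_cont.
    move: z; apply: continuous_in_subspaceT => z; rewrite inE => zS.
    apply: cvgM.
      exact: continuous_dot_mulmx.
    apply: cvgV.
      by rewrite mulf_neq0// gt_eqF// (lt_le_trans thm_gt0)// th_ge// stripE.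
    apply: cvgMl_tmp; apply: cvgD; first exact: cvg_cst.
    by apply: cvgMl_tmp; exact: cvg_fst.
  move: z; apply: continuous_in_subspaceT => z; rewrite inE => zS.
  apply: (@cvg_comp _ _ _ fst k); first exact: cvg_fst.
  by apply: ck; rewrite inE; case: zS.
move=> z zS rz; have tS := stripE z zS.
set w := `|z.2 - y|.
have zw : `|z.2| <= w + `|y| by rewrite -{1}(subrK y z.2) ler_normD.
have vz : v z <= C + `|K| * (w + `|y|).
  apply: le_trans (vCK z zS) _; rewrite lerD2l.
  apply: le_trans (ler_norm _) _; rewrite normrM normr_id.
  by rewrite ler_wpM2l.
have Qz : c * w ^+ 2 <= Q (z.2 - y) / (2 * th z.1).
  have thz0 : 0 < th z.1 by apply: lt_le_trans (th_ge _ tS).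
  apply: (@le_trans _ _ (c * (D * Q (z.2 - y)))).
    by apply: ler_wpM2l; [exact: ltW|exact: QD].
  rewrite (_ : c * _ = Q (z.2 - y) / (2 * thM)); last first.
    by rewrite /c; field; rewrite !gt_eqF.
  apply: ler_wpM2l; first exact: posdef_invmx_ge0.
  by rewrite lef_pV2 ?posrE ?mulr_gt0// ler_pM2l// th_le.
have kz := k0 _ tS.
have {}hr : C + `|K| * `|y| - f (0, y) + `|K| * w <= c * w ^+ 2.
  by apply: hr; lra.
by rewrite {1}/f; lra.
Qed.

(** A maximum principle: the kernel solves the equation exactly and [v] is a subsolution, so an
    upper bound on their difference at time 0 persists. *)
Lemma kernel_monotone B :
  (forall x, v (0, x) - Q (x - y) / (2 * th 0) <= B) ->
  forall t x, 0 <= t < S -> v (t, x) - Q (x - y) / (2 * th t) <= B.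
Proof.
move=> vB t1 x1 /andP[t10 t1S]; rewrite leNgt; apply/negP => Bt1.
(* The penalty [k] below is small at [t1] but exceeds [F - B] at [S], so that a
   maximum of [v - kernel - k] lies strictly between [0] and [S]; there the
   polynomial [phi], touching [kernel + k] from above, violates [v_test] because
   [k] increases. *)
have [m mS mmax] : exists2 m, strip m & forall z, strip z ->
    v z - Q (z.2 - y) / (2 * th z.1) <= v m - Q (m.2 - y) / (2 * th m.1).
  have [||m mS mm] := kernel_penalized_max (fun=> 0) => //.
    by move=> t _; exact: cst_continuous.
  by exists m => // z /mm; rewrite !subr0.
set F := _ - _ in mmax; pose M0 := F - B.
have M0_gt0 : 0 < M0.
  rewrite subr_gt0; apply: lt_le_trans Bt1 (mmax (t1, x1) _).
  by split => //=; rewrite in_itv /= t10 ltW.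
set d := v (t1, x1) - _ in Bt1; have dB0 : 0 < d - B by rewrite subr_gt0.
have St1 : 0 < S - t1 by rewrite subr_gt0.
(* With this [al], [k S = M0], while [k t1] is below [M0 * al / (S - t1) = (d - B) / 2]. *)
pose al := (d - B) * (S - t1) / (2 * M0).
have al_gt0 : 0 < al by rewrite divr_gt0 ?mulr_gt0.
pose s t := S - t + al.
have s_ge t : 0 <= t <= S -> al <= s t.
  by move=> /andP[_ tS]; rewrite lerDr subr_ge0.
have s_gt0 t : 0 <= t <= S -> 0 < s t.
  by move=> /s_ge; exact: lt_le_trans.
pose k t := M0 * al / s t.
have [||[t0 x0] t0S fmax] := kernel_penalized_max k.
- move=> t; rewrite inE /= in_itv /= => tS.
  apply: cvgM; first exact: cvg_cst.
  apply: cvgV; first exact/lt0r_neq0/s_gt0.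
  by apply: cvgD; [apply: cvgB; [exact: cvg_cst|exact: cvg_id]|exact: cvg_cst].
- by move=> t tS; apply/ltW/divr_gt0; [exact: mulr_gt0|exact: s_gt0].
move: t0S => [] /=; rewrite in_itv /= => t0S _.
have kt1 : k t1 < d - B.
  rewrite /k ltr_pdivrMr; last by apply: s_gt0; rewrite t10 ltW.
  rewrite /s mulrDr {1}/al mulrC.
  have -> : (d - B) * (S - t1) / (2 * M0) * M0 = (d - B) * (S - t1) / 2.
    by field; rewrite gt_eqF.
  have dB : 0 < (d - B) * (S - t1) by rewrite mulr_gt0.
  have : 0 < (d - B) * al by rewrite mulr_gt0.
  lra.
have fB : B < v (t0, x0) - Q (x0 - y) / (2 * th t0) - k t0.
  apply: lt_le_trans (fmax (t1, x1) _).
    by rewrite /= -/d; lra.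
  by split => //=; rewrite in_itv /= t10 ltW.
have kpos : 0 < k t0 by apply: divr_gt0; [exact: mulr_gt0|exact: s_gt0].
(* At time 0 the penalized value is below [B] by [vB]; at time [S] it is at most [F - M0 = B]. Both
   contradict [fB]. *)
have t0i : 0 < t0 < S.
  move/andP: (t0S) => [t00 t0S']; apply/andP; split.
    rewrite lt_neqAle t00 andbT; apply/eqP => t0E; rewrite -t0E in fB kpos.
    by have := vB x0; lra.
  rewrite lt_neqAle t0S' andbT; apply/eqP => t0E; rewrite t0E in fB t0S.
  have : k S = M0 by rewrite /k /s subrr add0r mulfK ?gt_eqF.
  have := mmax (S, x0) _; rewrite /= => h kS; rewrite kS in fB.
  have {}h : v (S, x0) - Q (x0 - y) / (2 * th S) <= F.
    by apply: h; split => //=; rewrite in_itv /= lexx ltW.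
  by rewrite /M0 in fB; lra.
pose th' := th t0; have th'0 : 0 < th' by exact: lt_le_trans (th_ge _ t0S).
pose s0 := s t0; have s00 : 0 < s0 by exact: s_gt0.
(* Both time factors are replaced by their parabolas from [inv_le_quadratic], tangent at [t0], with
   lower bounds [thm] for [th] and [al] for [s]. *)
pose phi (z : R * 'cV[R]_n) := Q (z.2 - y) *
    (1 / (2 * th') + (- e / (2 * th' ^+ 2)) * (z.1 - t0)
      + e ^+ 2 / (2 * (thm * th' ^+ 2)) * (z.1 - t0) ^+ 2)
  + (M0 * al / s0 + M0 * al / s0 ^+ 2 * (z.1 - t0)
      + M0 * al / (al * s0 ^+ 2) * (z.1 - t0) ^+ 2).
have phi_smooth : Cinfty phi.
  move=> j; apply: CkD; last exact: Ck_quadratic_time.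
  by apply: CkM; [exact: Ck_dot_mulmx|exact: Ck_quadratic_time].
have phi_ge z : strip z -> Q (z.2 - y) / (2 * th z.1) + k z.1 <= phi z.
  move=> [/= zS _]; rewrite in_itv /= in zS; apply: lerD.
    apply: ler_wpM2l; first exact: posdef_invmx_ge0.
    have := inv_le_quadratic _ _ _ thm_gt0 (th_ge _ zS) th'0.
    have -> : th z.1 - th' = e * (z.1 - t0) by rewrite /th' /th; ring.
    have h2 : (0 : R) <= 2^-1 by [].
    move=> /(ler_wpM2l h2); rewrite -invfM => /le_trans; apply.
    rewrite le_eqVlt; apply/orP; left; apply/eqP.
    by field; rewrite !gt_eqF.
  have := inv_le_quadratic _ _ _ al_gt0 (s_ge _ zS) s00.
  have Mal : 0 <= M0 * al by rewrite mulr_ge0 ?ltW.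
  move=> /(ler_wpM2l Mal) /le_trans; apply.
  rewrite le_eqVlt; apply/orP; left; apply/eqP.
  rewrite (_ : s z.1 - s0 = - (z.1 - t0)); last by rewrite /s0 /s; ring.
  by field; rewrite !gt_eqF.
have phi_max : local_max (fun z => v z - phi z) (t0, x0).
  have phi0 : phi (t0, x0) = Q (x0 - y) / (2 * th t0) + k t0.
    by rewrite /phi /= subrr expr0n /= !mulr0 !addr0 mul1r.
  rewrite /local_max.
  have near_strip : \forall z \near (t0, x0), strip z.
    exists (`]0, S[%classic, setT) => /=; last first.
      move=> [t x] [/= tS _]; split => //=; move: tS; rewrite !in_itv /=.
      by move=> /andP[a b]; rewrite !ltW.
    split; last exact: filterT.
    apply: open_nbhs_nbhs; split; first exact: itv_open.
    by rewrite /= in_itv.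
  apply: filterS near_strip => z zS.
  have := fmax z zS; have := phi_ge z zS; rewrite phi0 /=; lra.
have := v_test _ phi_smooth _ _ t0i phi_max.
have -> : derive1 (fun t => phi (t, x0)) t0
    = Q (x0 - y) * (- e / (2 * th' ^+ 2)) + M0 * al / s0 ^+ 2.
  rewrite derive1E; apply: (derive_quadratic _
    (Q (x0 - y) * (e ^+ 2 / (2 * (thm * th' ^+ 2)))
     + M0 * al / (al * s0 ^+ 2))) => r.
  rewrite /phi /= subrr (_ : r *: 1 + t0 - t0 = r); last first.
    by rewrite addrK /GRing.scale /= mulr1.
  by rewrite expr0n /=; ring.
have -> : quadH A (grad (fun x => phi (t0, x)) x0)
    = 2 * (1 / (2 * th')) ^+ 2 * Q (x0 - y).
  rewrite -(grad_kernel _ (M0 * al / s0)); congr (quadH A (grad _ x0)).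
  by apply/funext => x; rewrite /phi /= subrr expr0n /= !mulr0 !addr0.
have : 0 < M0 * al / s0 ^+ 2.
  by apply: divr_gt0; [exact: mulr_gt0|exact: exprn_gt0].
set X := M0 * _ / _; set q := Q _.
(* The kernel terms cancel; only the positive slope [X] of the penalty is left. *)
have -> : q * (- e / (2 * th' ^+ 2)) + X + e * (2 * (1 / (2 * th')) ^+ 2 * q) = X.
  by field; rewrite gt_eqF.
by move=> X0; rewrite leNgt X0.
Qed.

End Kernel.

(** * The Hopf-Lax formula *)

Section Regularity.
Context {R : realType} {n : nat}.

Lemma LipP {f : 'cV[R]_n -> R} : Lip f ->
  exists2 K, 0 < K & forall x y, `|f x - f y| <= K * `|x - y|.
Proof.
move=> [K [_ hK]]; pose K' := `|K| + 1; exists K'; first by rewrite ltr_wpDl.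
have KK' : K < K' by apply: le_lt_trans (ler_norm K) _; rewrite ltrDl.
by move=> x y; exact: (hK K' KK' (x, y)).
Qed.

Lemma Lip_continuous {f : 'cV[R]_n -> R} : Lip f -> continuous f.
Proof.
move=> /LipP[K K0 fK] x; apply/(@cvgrPdist_lt _ _ _ (nbhs x)) => e e0.
apply/nbhs_ballP; exists (e / K) => [|y]; first exact: divr_gt0.
rewrite -ball_normE /= ltr_pdivlMr// mulrC; exact: le_lt_trans.
Qed.

Context {T : R} {u : R * 'cV[R]_n -> R}.
Let strip := `[0, T]%classic `*` [set: 'cV[R]_n].
Hypothesis (T0 : 0 < T) (u_uc : unif_continuous (u : subspace strip -> R)).

Lemma strip_uniform eps : 0 < eps -> exists2 d, 0 < d &
  forall z z', strip z -> strip z' -> `|z - z'| < d -> `|u z - u z'| < eps.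
Proof.
move=> e0; have [d d0 h] := (@unif_continuousP _ _ _ _).1 u_uc eps e0.
exists d => // z z' zS z'S zz'; have := h (z, z'); rewrite /= -ball_normE; apply.
rewrite ball_subspace_ball /subspace_ball; case: ifPn => [_|/negP]; last first.
  by rewrite inE.
by split => //; rewrite -ball_normE.
Qed.

Lemma strip_continuous : {within strip, continuous u}.
Proof.
apply/subspace_continuousP => z zS; apply/cvgrPdist_lt => e e0.
have [d d0 h] := strip_uniform e e0.
apply/nbhs_ballP; exists d => // z'.
by rewrite -ball_normE /= => zz' z'S; exact: h.
Qed.

Lemma norm_time (s t : R) (x : 'cV[R]_n) : `|(s, x) - (t, x)| = `|s - t|.
Proof.
by rewrite prod_normE /= subrr normr0; apply/max_idPl; exact: normr_ge0.
Qed.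

(** Uniform continuity gives a time step [d / 2] over which [u] varies by less than 1, uniformly in
    [x]; finitely many such steps cover [[0, T]]. *)
Lemma strip_time_bounded : exists C, forall t x, 0 <= t <= T ->
  `|u (t, x) - u (0, x)| <= C.
Proof.
have [d d0 h] := strip_uniform 1 ltr01.
have inS t x : 0 <= t <= T -> strip (t, x).
  by move=> tT; split => //=; rewrite in_itv.
have key (N : nat) t x : 0 <= t <= T -> t <= N%:R * (d / 2) ->
    `|u (t, x) - u (0, x)| <= N%:R.
  elim: N t => [|N ih] t /andP[t0 tT] tN.
    rewrite mul0r in tN; have -> : t = 0 by apply/eqP; rewrite eq_le tN.
    by rewrite subrr normr0.
  have [td|td] := leP t (d / 2).
    apply: (@le_trans _ _ 1); last by rewrite ler1n.
    apply/ltW/h; [by apply: inS; rewrite t0| |].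
      by apply: inS; rewrite lexx ltW.
    by rewrite norm_time subr0 ger0_norm//; lra.
  rewrite -(subrKA (u (t - d / 2, x))) (le_trans (ler_normD _ _))//.
  rewrite -[N.+1%:R]natr1 addrC lerD//.
    by apply: ih; [apply/andP; split; lra|move: tN; rewrite -[N.+1%:R]natr1; lra].
  apply/ltW/h; [by apply: inS; rewrite t0| |].
    by apply: inS; apply/andP; split; lra.
  by rewrite norm_time opprB addrC subrK ger0_norm; lra.
exists (Num.truncn (T / (d / 2))).+1%:R => t x /andP[t0 tT].
apply: key; rewrite ?t0// (le_trans tT)// -ler_pdivrMr ?divr_gt0//.
exact/ltW/truncnS_gt.
Qed.

Lemma strip_growth : Lip (fun x => u (0, x)) ->
  exists C K, forall z, strip z -> `|u z| <= C + K * `|z.2|.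
Proof.
move=> /LipP[K K0 uK]; have [C hC] := strip_time_bounded.
exists (C + `|u (0, 0)|), K => -[t x] [/= ]; rewrite in_itv /= => tT _.
have := uK x 0; have := hC t x tT; rewrite subr0.
move=> h1 h2.
have -> : u (t, x) = u (t, x) - u (0, x) + (u (0, x) - u (0, 0)) + u (0, 0) by ring.
apply: le_trans (ler_normD _ _) _; rewrite [leRHS]addrAC lerD2r.
by apply: le_trans (ler_normD _ _) _; exact: lerD.
Qed.

(** The comparison argument only reaches times before [T]; this limit carries its bounds to [T]. *)
Lemma strip_cvg_left x : u (t, x) @[t --> T^'-] --> u (T, x).
Proof.
apply/cvgrPdist_lt => e e0; have [d d0 h] := strip_uniform e e0.
near=> t; apply: h.
- by split => //=; rewrite in_itv /= lexx ltW.
- split => //=; rewrite in_itv /=; apply/andP; split; first by near: t; exact: nbhs_left_ge.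
  by apply/ltW.
rewrite norm_time ger0_norm; last by rewrite subr_ge0; exact/ltW.
rewrite ltrBlDr -ltrBlDl; near: t; apply: nbhs_left_gt.
by rewrite ltrBlDr ltrDl.
Unshelve. all: by end_near. Qed.

End Regularity.

(** * The two Hopf-Lax inequalities and the attained minimum *)

Section HopfLax.
Context {R : realType} {n : nat} {A : 'M[R]_n}.
Hypothesis hA : posdefmx A.
Let M := invmx A.
Let Q x := dot (M *m x) x.

Lemma derive1_gradN (phi : R * 'cV[R]_n -> R) t0 x0 : Cinfty phi ->
  derive1 (fun t => - phi (t, x0)) t0 = - derive1 (fun t => phi (t, x0)) t0 /\
  grad (fun x => - phi (t0, x)) x0 = - grad (fun x => phi (t0, x)) x0.
Proof.
move=> /(_ 1)[dphi _]; split.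
  apply: derive1N; apply: diff_derivable.
  exact: (@differentiable_comp _ _ _ _ (fun t => (t, x0)) phi).
apply/colP => i; rewrite !mxE; apply: deriveN; apply: diff_derivable.
exact: (@differentiable_comp _ _ _ _ (fun x => (t0, x)) phi).
Qed.

Lemma quadHN p : quadH A (- p) = quadH A p.
Proof. by rewrite /quadH dot_mulmxN. Qed.

Context {T : R} {u : R * 'cV[R]_n -> R}.
Hypotheses (T0 : 0 < T) (u_sol : viscosity_solution (quadH A) T u).
Hypothesis u0_Lip : Lip (fun x => u (0, x)).

Lemma hopf_lax_le x y : u (T, x) <= u (0, y) + Q (x - y) / (2 * T).
Proof.
have [K K0 uK] := LipP u0_Lip; have [D D0 QD] := posdef_invmx_coercive hA.
have u_uc := viscosity_uc u_sol.
have Q0 : 0 <= Q (x - y) by exact: posdef_invmx_ge0.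
have lt_T t : 0 < t < T -> u (t, x) <= u (0, y) + Q (x - y) / (2 * t).
  move=> /andP[t0 tT]; apply/ler_addgt0Pr => eps eps0.
  (* The shift [tau] removes the singularity of the kernel at time 0. Its size makes [eps / 2] the
     maximum over [w] of [K * w - w ^+ 2 / (D * (2 * tau))]. *)
  pose tau := eps / (K ^+ 2 * D).
  have tau0 : 0 < tau by rewrite divr_gt0// mulr_gt0// exprn_gt0.
  have h : u (t, x) - Q (x - y) / (2 * (tau + 1 * t)) <= u (0, y) + eps / 2.
    apply: (kernel_monotone hA 1 tau T); rewrite ?mulr0 ?addr0 ?mul1r//.
    - exact: addr_gt0.
    - exact: strip_continuous.
    - have [C [K' h]] := strip_growth T0 u_uc u0_Lip; exists C, K' => z zS.
      exact: le_trans (ler_norm _) (h z zS).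
    - move=> phi phiC s0 x0 s0T pmax; rewrite mul1r.
      exact: (viscosity_sub u_sol phiC s0T pmax).
    - move=> x'; set w := `|x' - y|.
      have uw : u (0, x') <= u (0, y) + K * w.
        by rewrite -lerBlDl (le_trans (ler_norm _))// uK.
      have Qw : w ^+ 2 / (D * (2 * tau)) <= Q (x' - y) / (2 * tau).
        rewrite invfM mulrA; apply: ler_wpM2r.
          by rewrite invr_ge0 mulr_ge0// ltW.
        by rewrite ler_pdivrMr// mulrC; exact: QD.
      (* AM-GM *)
      have Kw : K * w <= w ^+ 2 / (D * (2 * tau)) + eps / 2.
        rewrite -subr_ge0.
        have -> : w ^+ 2 / (D * (2 * tau)) + eps / 2 - K * w =
            (K * w - eps) ^+ 2 / (2 * eps).
          by rewrite /tau; field; rewrite !gt_eqF.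
        by rewrite divr_ge0 ?sqr_ge0 ?mulr_ge0 ?ltW.
      suff : u (0, x') - Q (x' - y) / (2 * tau) <= u (0, y) + eps / 2 by [].
      by lra.
    - by rewrite ltW.
  have : Q (x - y) / (2 * (tau + 1 * t)) <= Q (x - y) / (2 * t).
    rewrite ler_wpM2l// lef_pV2 ?posrE ?mulr_gt0 ?addr_gt0 ?mul1r//.
    by rewrite ler_pM2l// lerDr ltW.
  by lra.
apply: (ler_cvg_to (strip_cvg_left T0 u_uc x)
  (_ : u (0, y) + Q (x - y) / (2 * t) @[t --> T^'-] --> _)).
  apply: cvgD; first exact: cvg_cst.
  apply: cvgMl_tmp; apply: cvgV; first by rewrite mulf_neq0// gt_eqF.
  apply: cvgMl_tmp; exact: cvg_at_left_filter cvg_id.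
by near=> t; apply: lt_T; apply/andP; split.
Unshelve. all: by end_near. Qed.

Lemma hopf_lax_ge x m : (forall y, m <= u (0, y) + Q (x - y) / (2 * T)) ->
  m <= u (T, x).
Proof.
move=> hm; have u_uc := viscosity_uc u_sol.
have lt_T t : 0 < t < T -> m <= u (t, x).
  (* The backward kernel is singular at [T], so the comparison runs on [[0, S]] with [t < S < T].
     The kernel is centred at [x] and thus vanishes at [(t, x)]. *)
  move=> /andP[t0 tT]; pose S := (t + T) / 2.
  have tS : t < S by rewrite /S; lra.
  have ST : S < T by rewrite /S; lra.
  have SS : `[0, S]%classic `*` [set: 'cV[R]_n]
      `<=` `[0, T]%classic `*` [set: 'cV[R]_n].
    move=> [s z] [/= sS _]; split => //=; move: sS; rewrite !in_itv /=.
    by move=> /andP[-> /le_trans]; apply; exact: ltW.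
  have : - u (t, x) - Q (x - x) / (2 * (T + -1 * t)) <= - m.
    apply: (kernel_monotone hA (-1) T S (fun z => - u z)); rewrite ?mulr0 ?addr0//.
    - exact: lt_trans tS.
    - by rewrite mulN1r subr_gt0.
    - apply: continuous_subspaceW SS _ => z; apply: cvgN.
      exact: strip_continuous.
    - have [C [K' h]] := strip_growth T0 u_uc u0_Lip; exists C, K' => z zS.
      rewrite (le_trans (ler_norm _))// normrN; exact/h/SS.
    - move=> phi phiC s0 x0 /andP[s00 s0S] pmax.
      have [d1N gN] := derive1_gradN phi s0 x0 phiC.
      have s0T : 0 < s0 < T by rewrite s00 (lt_trans s0S).
      (* A local maximum of [- u - phi] is a local minimum of [u - (- phi)]; as [H] is even, the
         supersolution inequality for [- phi] is the required one with its sign reversed. *)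
      have := viscosity_super u_sol (CinftyN _ phiC) (x0 := x0) s0T.
      rewrite d1N gN quadHN => h.
      rewrite mulN1r -oppr_ge0 opprD opprK; apply: h.
      apply: filterS pmax => z /=; lra.
    - move=> x'; have := hm x'.
      have <- : Q (x' - x) = Q (x - x') by rewrite -[LHS]dot_mulmxN opprB.
      by move=> ?; suff : - u (0, x') - Q (x' - x) / (2 * T) <= - m by []; lra.
    - by rewrite (ltW t0).
  by rewrite subrr /Q mulmx0 dot0l mul0r subr0 lerN2.
apply: (cvgr_to_ge (strip_cvg_left T0 u_uc x)).
by near=> t; apply: lt_T; apply/andP; split.
Unshelve. all: by end_near. Qed.

(** Quadratic growth beats the Lipschitz bound, so a minimizer exists; [hopf_lax_ge] is then applied
    with [m] the minimal value. *)
Lemma hopf_lax_min x : exists y, u (T, x) = u (0, y) + Q (x - y) / (2 * T).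
Proof.
pose f (z : R * 'cV[R]_n) := - (u (0, z.2) + Q (x - z.2) / (2 * T)).
have [K K0 uK] := LipP u0_Lip; have [D D0 QD] := posdef_invmx_coercive hA.
have cf : continuous f.
  move=> z; apply: cvgN; apply: cvgD.
    apply: (@cvg_comp _ _ _ snd (fun y => u (0, y))); first exact: cvg_snd.
    exact: Lip_continuous.
  apply: cvgMr_tmp.
  have QE : (fun z : R * 'cV[R]_n => Q (x - z.2)) = fun z => Q (z.2 - x).
    by apply/funext => z'; rewrite -[RHS]dot_mulmxN opprB.
  have := continuous_dot_mulmx M x z.
  by rewrite -/M -/(Q _) -QE.
pose c := (D * (2 * T))^-1; have c0 : 0 < c by rewrite invr_gt0 !mulr_gt0.
have [r hr] := linear_le_quadratic 0 K c c0.
have [|||[t y] _ ymax] := strip_max 0 (r + `|x|) f (0, x).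
- exact: continuous_subspaceT.
- by split => //=; rewrite in_itv /= lexx.
- move=> z _ rz; set w := `|x - z.2|.
  have zw : `|z.2| <= w + `|x|.
    by rewrite /w distrC -{1}(subrK x z.2) ler_normD.
  have := hr w; rewrite add0r => {}hr.
  have {}hr : K * w <= c * w ^+ 2 by apply: hr; lra.
  have Qz : c * w ^+ 2 <= Q (x - z.2) / (2 * T).
    apply: (@le_trans _ _ (c * (D * Q (x - z.2)))).
      by apply: ler_wpM2l; [exact: ltW|exact: QD].
    by rewrite /c le_eqVlt; apply/orP; left; apply/eqP; field; rewrite !gt_eqF.
  have := uK x z.2; rewrite ler_norml => /andP[_ uz].
  rewrite /f /= subrr [Q 0]/Q mulmx0 dot0l mul0r -/w in uz *.
  by lra.
have h z : u (0, y) + Q (x - y) / (2 * T) <= u (0, z) + Q (x - z) / (2 * T).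
  rewrite -lerN2; apply: (ymax (0, z)).
  by split => //=; rewrite in_itv /= lexx.
exists y; apply/eqP; rewrite eq_le hopf_lax_le /=.
exact: hopf_lax_ge.
Qed.

End HopfLax.

(** * Minimizers of the Hopf-Lax formula *)

Section Minimizers.
Context {R : realType} {n : nat} {A : 'M[R]_n}.
Hypothesis hA : posdefmx A.
Let M := invmx A.
Let Q x := dot (M *m x) x.
Context {T : R} {u0 uT : 'cV[R]_n -> R}.
Hypotheses (T0 : 0 < T) (u0_Lip : Lip u0).
Hypothesis uT_le : forall x y, uT x <= u0 y + Q (x - y) / (2 * T).
Hypothesis uT_min : forall x, exists y, uT x = u0 y + Q (x - y) / (2 * T).

Let sM : M^T = M := posdef_invmx_sym hA.

Lemma quadB x y : Q (x - y) = Q x - 2 * dot (M *m x) y + Q y.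
Proof. by rewrite /Q (dot_symD _ _ sM) dotNr dot_mulmxN; ring. Qed.

Lemma quad_shift z h y :
  Q (z + h - y) = Q (z - y) + 2 * dot (M *m h) (z - y) + Q h.
Proof. by rewrite addrAC /Q (dot_symD _ _ sM) (dot_symC _ _ sM). Qed.

(** The kernel centred at [y], raised by [u0 y], lies above [uT] and touches it at [z];
    [derive_le_quadratic] on each coordinate line identifies the gradient. *)
Lemma minimizer_of_diff z y : differentiable uT z ->
  uT z = u0 y + Q (z - y) / (2 * T) -> z - T *: grad (quadH A) (grad uT z) = y.
Proof.
move=> duT uTz.
have -> : grad uT z = T^-1 *: (M *m (z - y)).
  apply/colP => i; rewrite [LHS]mxE [RHS]mxE -(dot_delta (M *m _)).
  apply: (derive_le_quadratic _ (Q (delta_mx i 0) / (2 * T))) => [|s].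
    exact: diff_derivable.
  apply: le_trans (uT_le _ y) _; rewrite uTz.
  rewrite (_ : s *: delta_mx i 0 + z - y = z - y + s *: delta_mx i 0); last first.
    by rewrite -addrA addrC.
  rewrite /Q (dot_symD _ _ sM) dot_mulmxZ dotZr.
  by rewrite le_eqVlt; apply/orP; left; apply/eqP; field; rewrite gt_eqF.
rewrite (grad_quadH _ _ hA.1) -scalemxAr scalerA divff ?gt_eqF// scale1r.
by rewrite mulKVmx ?posdef_unitmx// subKr.
Qed.

Variables z x0 : 'cV[R]_n.
Let G y := u0 y + Q (z - y) / (2 * T).
Hypothesis G_strict : forall y, y != x0 -> G x0 < G y.

Lemma strict_min_coercive : exists r, forall y, r < `|y - x0| ->
  `|y - x0| <= G y - G x0.
Proof.
have [K K0 u0K] := LipP u0_Lip; have [D D0 QD] := posdef_invmx_coercive hA.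
have [C C0 hC] := dot_mulmx_bound M.
pose c := (D * (2 * T))^-1; have c0 : 0 < c by rewrite invr_gt0 !mulr_gt0.
(* [K] and the last summand absorb the linear terms of [G y - G x0]; the 1 leaves the claimed lower
   bound [|y - x0|]. *)
pose K' := 1 + K + C * `|z - x0| / T.
have [r hr] := linear_le_quadratic 0 K' c c0; exists r => y.
set w := `|y - x0| => /hr {}hr.
have zy : z - y = (z - x0) - (y - x0) by rewrite opprB addrA subrK.
have uy : u0 x0 - u0 y <= K * w.
  by apply: le_trans (ler_norm _) _; rewrite /w distrC; exact: u0K.
have Qd : c * w ^+ 2 <= Q (y - x0) / (2 * T).
  apply: (@le_trans _ _ (c * (D * Q (y - x0)))).
    by apply: ler_wpM2l; [exact: ltW|exact: QD].
  by rewrite /c le_eqVlt; apply/orP; left; apply/eqP; field; rewrite !gt_eqF.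
have dd : dot (M *m (z - x0)) (y - x0) / T <= C * `|z - x0| / T * w.
  rewrite mulrAC ler_wpM2r ?invr_ge0 ?(ltW T0)//.
  by apply: le_trans (ler_norm _) _; exact: hC.
have -> : G y - G x0 = u0 y - u0 x0 - dot (M *m (z - x0)) (y - x0) / T
    + Q (y - x0) / (2 * T).
  by rewrite /G zy quadB; field; rewrite gt_eqF.
by move: hr; rewrite /K'; lra.
Qed.

(** Compactness gives a positive gap at bounded distance from [x0], coercivity the rest. The gap is
    linear in [|y - x0|] so that this factor cancels in [minimizer_continuous]. *)
Lemma strict_min_gap eps : 0 < eps -> exists2 g, 0 < g &
  forall y, eps <= `|y - x0| -> g * `|y - x0| <= G y - G x0.
Proof.
move=> e0; have [r hr] := strict_min_coercive.
(* The added term is twice the positive part of [eps - |y - x0|]: it vanishes outside the [eps]-ball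
   and is positive at [x0], so one can minimize over the whole space. *)
pose f (p : R * 'cV[R]_n) :=
  - (G p.2 - G x0 + (`|eps - `|p.2 - x0| | + (eps - `|p.2 - x0|))).
have c2 : continuous (fun p : R * 'cV[R]_n => `|p.2 - x0|).
  move=> p; apply: cvg_norm; apply: cvgB; [exact: cvg_snd|exact: cvg_cst].
have ce : continuous (fun p : R * 'cV[R]_n => eps - `|p.2 - x0|).
  by move=> p; apply: cvgB; [exact: cvg_cst|exact: c2].
have cf : continuous f.
  move=> p; apply: cvgN; apply: cvgD.
    apply: cvgB; last exact: cvg_cst.
    apply: cvgD.
      apply: (@cvg_comp _ _ _ snd u0); [exact: cvg_snd|exact: Lip_continuous].
    apply: cvgMr_tmp.
    have QE : (fun p : R * 'cV[R]_n => Q (z - p.2)) = fun p => Q (p.2 - z).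
      by apply/funext => p'; rewrite -[RHS]dot_mulmxN opprB.
    by have := continuous_dot_mulmx M z p; rewrite -/(Q _) -QE.
  apply: cvgD; last exact: ce.
  by apply: cvg_norm; exact: ce.
(* Beyond [r'] the gap exceeds [2 * eps], the value of [- f] at [x0]. *)
pose r' := Num.max r (2 * eps).
have G0 y : 0 <= G y - G x0.
  have [->|/G_strict/ltW] := eqVneq y x0; last by rewrite subr_ge0.
  by rewrite subrr.
have [|||[t m] _ mmax] := strip_max 0 (r' + `|x0|) f (0, x0).
- exact: continuous_subspaceT.
- by split => //=; rewrite in_itv /= lexx.
- move=> p _ rp; rewrite /f /= !subrr normr0 subr0 (gtr0_norm e0) add0r lerN2.
  have : r' < `|p.2 - x0|.
    have : `|p.2| <= `|p.2 - x0| + `|x0| by rewrite -{1}(subrK x0 p.2) ler_normD.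
    by lra.
  rewrite gt_max => /andP[/hr h1 h2].
  by have := ler_norm (- (eps - `|p.2 - x0|)); rewrite normrN; lra.
pose mu := - f (t, m).
have mu0 : 0 < mu.
  rewrite /mu opprK /=; have [->|mx] := eqVneq m x0.
    by rewrite !subrr normr0 subr0 (gtr0_norm e0); lra.
  apply: ltr_pwDl; first by rewrite subr_gt0 G_strict.
  have := ler_norm (- (eps - `|m - x0|)); rewrite normrN; lra.
have r'0 : 0 < r' by rewrite lt_max; apply/orP; right; rewrite mulr_gt0.
exists (Num.min 1 (mu / r')).
  by rewrite lt_min ltr01 divr_gt0.
move=> y ey; have [yr|yr] := ltP r `|y - x0|.
  apply: le_trans (hr _ yr).
  by rewrite -[leRHS]mul1r ler_wpM2r// ge_min lexx.
have muG : mu <= G y - G x0.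
  have := mmax (0, y); rewrite -lerN2 -/mu => /(_ _)/le_trans; apply.
    by split => //=; rewrite in_itv /= lexx.
  rewrite opprK /= ler0_norm; last by rewrite subr_le0.
  by rewrite addNr addr0.
apply: le_trans muG; rewrite -[leRHS](divfK (lt0r_neq0 r'0)).
apply: ler_pM => //; first by rewrite le_min ler01 divr_ge0// ltW.
  by rewrite ge_min lexx orbT.
by rewrite /r' le_max yr.
Qed.

(** Moving [z] by [h] changes the cost of [y] relative to that of [x0] by only
    [dot (M *m h) (y - x0) / T], too little to close the gap when [h] is small. *)
Lemma minimizer_continuous eps : 0 < eps -> exists2 d, 0 < d &
  forall h y, `|h| < d -> uT (z + h) = u0 y + Q (z + h - y) / (2 * T) ->
    `|y - x0| < eps.
Proof.
move=> e0; have [g g0 hg] := strict_min_gap _ e0.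
have [C C0 hC] := dot_mulmx_bound M.
exists (g * T / C); first by rewrite divr_gt0 ?mulr_gt0.
move=> h y hd yE; rewrite ltNge; apply/negP => ey.
have w0 : 0 < `|y - x0| by exact: lt_le_trans ey.
have h1 := uT_le (z + h) x0; rewrite yE in h1.
have h2 : G y - G x0 <= dot (M *m h) (y - x0) / T.
  rewrite -subr_ge0 in h1; rewrite -subr_ge0; apply: le_trans h1 _.
  rewrite /G !quad_shift !dotDr !dotNr.
  by rewrite le_eqVlt; apply/orP; left; apply/eqP; field; rewrite gt_eqF.
have h3 : g * `|y - x0| <= C * `|h| * `|y - x0| / T.
  apply: le_trans (hg y ey) _; apply: le_trans h2 _.
  rewrite ler_wpM2r ?invr_ge0 ?(ltW T0)//.
  by apply: le_trans (ler_norm _) _; exact: hC.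
move: hd; rewrite ltr_pdivlMr// mulrC ltNge; apply/negP; rewrite negbK.
rewrite mulrAC ler_pM2r// in h3.
by rewrite -ler_pdivlMr.
Qed.

(** The derivative is [h |-> dot (M *m (z - x0)) h / T]. The upper estimate uses [x0] as competitor
    at [z + h]; the lower one uses a minimizer for [z + h] as competitor at [z]. *)
Lemma diff_of_strict_min : differentiable uT z.
Proof.
have uTz : uT z = G x0.
  have [y yE] := uT_min z; apply/eqP; rewrite eq_le uT_le yE /=.
  by have [->|/G_strict/ltW//] := eqVneq y x0; exact: lexx.
have [C C0 hC] := dot_mulmx_bound M.
pose L h := dot (M *m (z - x0)) h / T.
have L_lin : linear L.
  by move=> a x y; rewrite /L dotDr dotZr /GRing.scale /=; ring.
pose L_linear := GRing.isLinear.Build _ _ _ _ _ L_lin.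
pose L' : {linear 'cV[R]_n -> R} := HB.pack L L_linear.
have L_cont : continuous L'.
  move=> x; apply/(@cvgrPdist_lt _ _ _ (nbhs x)) => e e0.
  pose k := C * `|z - x0| / T + 1.
  have k0 : 0 < k by rewrite ltr_wpDl// divr_ge0 ?(ltW T0)// mulr_ge0// ltW.
  apply/nbhs_ballP; exists (e / k) => [|y]; first exact: divr_gt0.
  rewrite -ball_normE /= ltr_pdivlMr// mulrC; apply: le_lt_trans.
  rewrite -[L' x - L' y]linearB -[L' _]/(L _) /L normrM normfV (gtr0_norm T0).
  apply: (@le_trans _ _ (C * `|z - x0| / T * `|x - y|)).
    by rewrite mulrAC; apply: ler_wpM2r; [rewrite invr_ge0 ltW|exact: hC].
  by apply: ler_wpM2r => //; rewrite lerDl.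
apply: (differentiable_approx L') => // e e0.
(* If [|h|] and [|y - x0|] are below this radius, both error terms are at most [e * |h|]. *)
have eTC : 0 < e * T / C by rewrite divr_gt0 ?mulr_gt0.
have [d d0 hd] := minimizer_continuous _ eTC.
apply/nbhs_ballP; exists (Num.min d (e * T / C)) => [|h].
  by rewrite /= lt_min d0 eTC.
rewrite -ball_normE /= sub0r normrN lt_min => /andP[hd1 hd2].
have CT k : k <= C * `|h| * (e * T / C) -> k / T <= e * `|h|.
  move=> kC; rewrite ler_pdivrMr//; apply: le_trans kC _.
  by rewrite le_eqVlt; apply/orP; left; apply/eqP; field; rewrite gt_eqF.
have Ch0 : 0 <= C * `|h| by rewrite mulr_ge0// ltW.
have Qh0 : 0 <= Q h by exact: posdef_invmx_ge0.
have QhT : 0 <= Q h / T by rewrite divr_ge0// ltW.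
have LE y : dot (M *m h) (z - y) / T = L h - dot (M *m h) (y - x0) / T.
  by rewrite /L (dot_symC _ h sM) !dotDr !dotNr; ring.
have half a : a / (2 * T) = a / T / 2 by field; rewrite gt_eqF.
rewrite ler_norml; apply/andP; split.
  have [y yE] := uT_min (z + h); have yd := hd h y hd1 yE.
  have := uT_le z y; rewrite yE quad_shift.
  have /CT : dot (M *m h) (y - x0) <= C * `|h| * (e * T / C).
    apply: le_trans (ler_norm _) _; apply: le_trans (hC _ _) _.
    by apply: ler_wpM2l => //; exact: ltW.
  by have := LE y; rewrite !half; lra.
have := uT_le (z + h) x0; rewrite quad_shift uTz /G.
have /CT : Q h <= C * `|h| * (e * T / C).
  apply: le_trans (ler_norm _) _; apply: le_trans (hC _ _) _.
  by apply: ler_wpM2l => //; exact: ltW.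
by have := LE x0; rewrite subrr dot0r mul0r subr0 !half; lra.
Qed.

End Minimizers.

Theorem theorem2p4 (R : realType) (n : nat) (hn : (1 <= n)%N)
    (A : 'M[R]_n) (hA : posdefmx A) (T : R) (hT : 0 < T)
    (uT : 'cV[R]_n -> R) (huT : Lip uT)
    (hne : I_T (quadH A) T uT !=set0)
    (u0 : 'cV[R]_n -> R) (hu0 : I_T (quadH A) T uT u0)
    (x0 : 'cV[R]_n) :
  X_T (quadH A) T uT x0 <->
  exists (b : 'cV[R]_n) (c : R),
    u0 x0 = - (dot (invmx A *m x0) x0 / (2 * T)) + dot b x0 + c /\
    forall x : 'cV[R]_n, x != x0 ->
      - (dot (invmx A *m x) x / (2 * T)) + dot b x + c < u0 x.
Proof.
have [u0_Lip [u [u_sol u0E uTE]]] := hu0.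
have u0E' : u0 = fun x => u (0, x) by apply/funext => x; rewrite u0E.
have u_Lip : Lip (fun x => u (0, x)) by rewrite -u0E'.
pose Q x := dot (invmx A *m x) x.
have uT_le x y : uT x <= u0 y + Q (x - y) / (2 * T).
  by rewrite -uTE -u0E; exact: hopf_lax_le.
have uT_min x : exists y, uT x = u0 y + Q (x - y) / (2 * T).
  have [y yE] := hopf_lax_min hA hT u_sol u_Lip x.
  by exists y; rewrite -uTE -u0E.
have minE := minimizer_of_diff hA hT uT_le.
split=> [[z /= dz <-]|[b [c [bx0 bx]]]].
  have [y yE] := uT_min z; rewrite (minE _ _ dz yE).
  (* These choices turn the paraboloid of (ii) into [uT z - Q (z - x) / (2 * T)]. *)
  exists (T^-1 *: (invmx A *m z)), (uT z - Q z / (2 * T)).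
  have E x : - (dot (invmx A *m x) x / (2 * T)) + dot (T^-1 *: (invmx A *m z)) x
      + (uT z - Q z / (2 * T)) = uT z - Q (z - x) / (2 * T).
    by rewrite /Q (quadB hA) dotZl; field; rewrite gt_eqF.
  split=> [|x xy]; first by rewrite E yE addrK.
  (* Equality would make [x] another minimizer at [z], but [minE] determines the minimizer from
     [z]. *)
  rewrite E ltrBlDr lt_neqAle uT_le andbT; apply: contra xy => /eqP xE.
  by rewrite -(minE _ _ dz yE) (minE _ _ dz xE).
(* This inverts the choice [b = A^-1 z / T] of the other direction. *)
pose z := T *: (A *m b).
have E x : Q (z - x) / (2 * T) = Q z / (2 * T) - dot b x + Q x / (2 * T).
  have Mz : invmx A *m z = T *: b by rewrite -scalemxAr mulKmx ?posdef_unitmx.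
  rewrite /Q (quadB hA) Mz !dotZl.
  by field; rewrite gt_eqF.
have G_strict y : y != x0 ->
    u0 x0 + Q (z - x0) / (2 * T) < u0 y + Q (z - y) / (2 * T).
  by move=> /bx; rewrite -!/(Q _) !E bx0 -!/(Q _); lra.
have dz : differentiable uT z := diff_of_strict_min hA hT u0_Lip uT_le uT_min _ _ G_strict.
exists z => //; have [y yE] := uT_min z.
(* A minimizer other than [x0] would cost strictly more than [x0]. *)
have [yx|/G_strict] := eqVneq y x0; first by rewrite (minE _ _ dz yE).
by rewrite -yE ltNge uT_le.
Qed.
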